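(* Let $\mathcal{F}$ be a convex class of probability distributions on $\mathsf{O}$. If $T: \mathcal{F} \to \mathbb{R}$ is a non-constant max-functional, then $T$ is not elicitable.
   Context: $\mathsf{O} \subseteq \mathbb{R}^d$ is a fixed set (observation domain) equipped with its Borel $\sigma$-algebra. For a convex class $\mathcal{F}$ of probability distributions on $\mathsf{O}$, a functional $T: \mathcal{F} \to \mathbb{R}$ is a max-functional if $T(\lambda F_1 + (1-\lambda) F_0) = \max(T(F_0), T(F_1))$ for all $F_0, F_1 \in \mathcal{F}$ and $\lambda \in (0,1)$. For a functional $T: \mathcal{F} \to \mathsf{A} \subseteq \mathbb{R}^n$ (here $\mathsf{A} = \mathbb{R}$), a scoring function is a map $S: \mathsf{A} \times \mathsf{O} \to \mathbb{R}$ such that for every $x \in \mathsf{A}$ the function $y \mapsto S(x,y)$ is measurable and integrable with respect to every $F \in \mathcal{F}$; write $\bar S(x,F) := \int_{\mathsf{O}} S(x,y)\, dF(y)$. The scoring function $S$ is strictly $\mathcal{F}$-consistent for $T$ if for all $x \in \mathsf{A}$ and $F \in \mathcal{F}$ we have $\bar S(x,F) \ge \bar S(T(F),F)$, and equality implies $x = T(F)$. The functional $T$ is elicitable if there exists a strictly $\mathcal{F}$-consistent scoring function for $T$. *)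

(* Defs.v *)
From HB Require Import structures.
From mathcomp Require Import all_boot all_order all_algebra.
From mathcomp Require Import all_classical all_reals all_analysis.

Set Implicit Arguments.
Unset Strict Implicit.
Unset Printing Implicit Defensive.
Import Order.TTheory GRing.Theory Num.Theory.
Import numFieldNormedType.Exports.
Local Open Scope classical_set_scope.
Local Open Scope ring_scope.

(* [obs_domain O0] is the subset O of R^d seen as a type, with the subspace
   topology. Measurable types are pointed in the library, hence the proof O0
   that O is nonempty; when O is empty it carries no probability distribution,
   so nothing is lost. *)
Definition obs_domain (R : realType) (d : nat) (O : set 'rV[R]_d)
  (O0 : O !=set0) : Type := set_type O.

Section obs_domain_instances.
Context (R : realType) (d : nat) (O : set 'rV[R]_d) (O0 : O !=set0).

Let obs_point : obs_domain O0 :=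
  SigSub (mem_set (svalP (cid O0))) : set_type O.

HB.instance Definition _ := Topological.copy (obs_domain O0) (set_type O).
HB.instance Definition _ := isPointed.Build (obs_domain O0) obs_point.

End obs_domain_instances.

Definition borel_obs (R : realType) (d : nat) (O : set 'rV[R]_d)
  (O0 : O !=set0) := g_sigma_algebraType (@open (obs_domain O0)).

HB.instance Definition _ (R : realType) (d : nat) (O : set 'rV[R]_d)
  (O0 : O !=set0) := Measurable.on (borel_obs O0).

Section mixture.
Context (dX : measure_display) (X : measurableType dX) (R : realType).
Variables (l : {i01 R}) (P Q : probability X R).

Definition mixture : set X -> \bar R :=
  measure_add (mscale l%:num%:nng P) (mscale (1 - l%:num)%:nng Q).

HB.instance Definition _ := Measure.on mixture.

Let mixture_setT : mixture [set: X] = 1%E.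
Proof.
rewrite /mixture measure_addE /= /mscale /=.
rewrite (probability_setT P) (probability_setT Q) !mule1 -EFinD.
by rewrite addrC subrK.
Qed.

HB.instance Definition _ :=
  Measure_isProbability.Build _ _ _ mixture mixture_setT.

End mixture.

(* Functionals on a class [F] are total functions on probability measures, of
   which only the values on [F] matter. A library measure is a function on all
   subsets, including the non-measurable ones; functionals are not required to
   identify measures that agree on measurable sets, so the case of functionals
   of distributions proper is included. *)
Section functionals.
Context (dX : measure_display) (X : measurableType dX) (R : realType).
Implicit Types (F : set (probability X R)) (T : probability X R -> R).
Implicit Types (S : R -> X -> R) (P : probability X R).

Definition convex_class F := forall (l : {i01 R}) (P Q : probability X R),
  F P -> F Q -> F (mixture l P Q).

Definition max_functional F T := forall (P0 P1 : probability X R) (l : {i01 R}),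
  F P0 -> F P1 -> 0 < l%:num < 1 ->
  T (mixture l P1 P0) = Num.max (T P0) (T P1).

Definition constant_on F T := exists c, forall P, F P -> T P = c.

Definition scoring_function F S := forall x : R,
  measurable_fun [set: X] (S x) /\
  forall P, F P -> P.-integrable [set: X] (EFin \o S x).

Definition expected_score S (x : R) P : R := (\int[P]_y S x y)%R.

Definition strictly_consistent F T S := forall (x : R) P, F P ->
  expected_score S (T P) P <= expected_score S x P /\
  (expected_score S x P = expected_score S (T P) P -> x = T P).

Definition elicitable F T := exists S,
  scoring_function F S /\ strictly_consistent F T S.

End functionals.

(* Main.v *)
Require Import Defs.
From mathcomp Require Import all_boot all_order all_algebra.
From mathcomp Require Import all_classical all_reals all_analysis.
From mathcomp Require Import measurable_realfun ring lra.
Import Order.TTheory GRing.Theory Num.Theory.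
Local Open Scope classical_set_scope.
Local Open Scope ring_scope.

(** A non-constant max-functional [T] has [P0], [P1] in the class with
    [T P0 < T P1], and then [T] equals [T P1] on the whole open segment from
    [P0] to [P1]: an arbitrarily small share of [P1] already forces the larger
    value. A strictly consistent score cannot jump that way. The excess of the
    expected score of the report [T P0] over that of the report [T P1] is affine
    along the segment ([expected_score_mixture]), and by strict consistency it is
    negative at [P0] and positive at [P1], so it vanishes at an interior mixture
    ([balancing_weight]). There the two distinct reports tie, although [T P1] should be the unique optimal one. *)

Lemma integrable_mscale (d : measure_display) (X : measurableType d)
    (R : realType) (m : {measure set X -> \bar R}) (k : {nonneg R})
    (D : set X) (f : X -> \bar R) :
  measurable D -> m.-integrable D f -> (mscale k m).-integrable D f.
Proof.
move=> mD /integrableP[mf foo]; apply/integrableP; split=> //.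
rewrite ge0_integral_mscale//; last exact: measurableT_comp.
by apply: lte_mul_pinfty => //; rewrite lee_fin.
Qed.

Lemma integral_mscale (d : measure_display) (X : measurableType d)
    (R : realType) (m : {measure set X -> \bar R}) (k : {nonneg R})
    (D : set X) (f : X -> \bar R) :
  measurable D -> m.-integrable D f ->
  (\int[mscale k m]_(x in D) f x = k%:num%:E * \int[m]_(x in D) f x)%E.
Proof.
move=> mD intf; have mf := measurable_int _ intf.
rewrite [LHS]integralE (integralE m) !ge0_integral_mscale//;
  [|exact: measurable_funeneg|exact: measurable_funepos].
rewrite [RHS]muleBr//; apply: fin_num_adde_defr.
by apply: integrable_pos_fin_num.
Qed.

Lemma expected_score_mixture (dX : measure_display) (X : measurableType dX)
    (R : realType) (S : R -> X -> R) (x : R) (l : {i01 R})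
    (P Q : probability X R) :
  P.-integrable [set: X] (EFin \o S x) ->
  Q.-integrable [set: X] (EFin \o S x) ->
  expected_score S x (mixture l P Q) =
  l%:num * expected_score S x P + (1 - l%:num) * expected_score S x Q.
Proof.
move=> iP iQ; rewrite /expected_score /Rintegral.
have finP := integrable_fin_num measurableT iP.
have finQ := integrable_fin_num measurableT iQ.
rewrite (@integral_measure_add _ _ _ (mscale _ P) (mscale _ Q))//;
  [|exact: integrable_mscale..].
rewrite !integral_mscale//.
by rewrite fineD ?fin_numM// !fineM.
Qed.

Lemma nonconstant_lt (dX : measure_display) (X : measurableType dX)
    (R : realType) (F : set (probability X R)) (T : probability X R -> R) :
  ~ constant_on F T ->
  exists P0 P1, [/\ F P0, F P1 & T P0 < T P1].
Proof.
move=> ncst; apply: contrapT => nlt; apply: ncst.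
have [[P0 FP0]|/forallNP F0] := pselect (exists P, F P); last first.
  (* On an empty class, any value serves as the constant. *)
  by exists 0 => P /F0.
exists (T P0) => P FP; apply/eqP; rewrite eq_le !leNgt.
by apply/andP; split; apply/negP => lt_T; apply: nlt; [exists P0, P|exists P, P0].
Qed.

(** The weight solves [l * b = (1 - l) * a]: it is where an affine function
    going from [- a] at [0] to [b] at [1] vanishes. *)
Lemma balancing_weight (R : realType) (a b : R) : 0 < a -> 0 < b ->
  exists2 l : {i01 R}, 0 < l%:num < 1 & l%:num * b = (1 - l%:num) * a.
Proof.
move=> a0 b0; have ab0 : 0 < a + b by lra.
have l0 : 0 < a / (a + b) by rewrite divr_gt0.
have l1 : a / (a + b) < 1 by rewrite ltr_pdivrMr// mul1r; lra.
exists (Itv01 (ltW l0) (ltW l1)); first by rewrite /= l0 l1.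
by rewrite /=; field; rewrite gt_eqF.
Qed.

Lemma strictly_consistent_lt (dX : measure_display) (X : measurableType dX)
    (R : realType) (F : set (probability X R)) (T : probability X R -> R)
    (S : R -> X -> R) (x : R) (P : probability X R) :
  strictly_consistent F T S -> F P -> x != T P ->
  expected_score S (T P) P < expected_score S x P.
Proof.
move=> SC FP xT; have [le_S uniq_x] := SC x P FP.
by rewrite lt_neqAle le_S andbT eq_sym; apply: contra_neq xT.
Qed.

Lemma max_functional_not_elicitable (dX : measure_display)
    (X : measurableType dX) (R : realType) (F : set (probability X R))
    (T : probability X R -> R) :
  convex_class F -> max_functional F T -> ~ constant_on F T ->
  ~ elicitable F T.
Proof.
move=> cvxF maxT /nonconstant_lt[P0 [P1 [FP0 FP1 lt01]]] [S [scS SC]].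
have gap0 : expected_score S (T P0) P0 < expected_score S (T P1) P0.
  by apply: strictly_consistent_lt SC FP0 _; rewrite gt_eqF.
have gap1 : expected_score S (T P1) P1 < expected_score S (T P0) P1.
  by apply: strictly_consistent_lt SC FP1 _; rewrite lt_eqF.
rewrite -subr_gt0 in gap0; rewrite -subr_gt0 in gap1.
have [l l01 tie] := balancing_weight _ _ _ gap0 gap1.
have TM : T (mixture l P1 P0) = T P1.
  by rewrite maxT// max_r// ltW.
have FM : F (mixture l P1 P0) by apply: cvxF.
have lt_M := strictly_consistent_lt _ _ _ _ _ _ (T P0) _ SC FM.
move: lt_M; rewrite TM lt_eqF// => /(_ isT).
have int x P : F P -> P.-integrable [set: X] (EFin \o S x).
  by case: (scS x) => _; apply.
rewrite !expected_score_mixture; [|exact: int..].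
by move: tie; lra.
Qed.

Theorem corollary3p4 (R : realType) (d : nat) (O : set 'rV[R]_d)
    (O0 : O !=set0) (F : set (probability (borel_obs O0) R))
    (T : probability (borel_obs O0) R -> R) :
  convex_class F -> max_functional F T -> ~ constant_on F T ->
  ~ elicitable F T.
Proof. exact: max_functional_not_elicitable. Qed.
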